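(* Let $M$ be a $0,1$ matrix with $\mathrm{rank}_{\mathbb{R}}(M) = 3$. Let $$C_4 = \begin{pmatrix} 1&1&0&0\\ 0&1&1&0\\ 0&0&1&1\\ 1&0&0&1\end{pmatrix}, \qquad A_7 = \begin{pmatrix} 1&1&0\\ 0&1&1\\ 1&1&1\end{pmatrix}.$$ Then: (1) The kernel of $M$ has at most $4$ rows or at most $4$ columns. (2) $\mathrm{rank}_{\mathrm{bin}}(M) = \mathrm{rank}_{\mathbb{B}}(M) = 4$ if and only if the kernel of $M$ contains, up to permutation of rows and columns, $C_4$ as a submatrix. (3) $i(M) = \mathrm{rank}_{\mathrm{bin}}(M) = \mathrm{rank}_{\mathbb{B}}(M)$ unless the kernel of $M$ is equal, up to permutation of rows and columns, to $A_7$, in which case $\mathrm{rank}_{\mathrm{bin}}(M) = 3$ and $\mathrm{rank}_{\mathbb{B}}(M) = i(M) = 2$.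
   Context: The kernel of a $0,1$ matrix $M$ is the submatrix obtained by deleting all all-zero rows and columns and all duplicate rows and columns of $M$ (keeping one row from each class of identical rows and one column from each class of identical columns); it is well defined up to permutation of rows and columns. $\mathrm{rank}_{\mathbb{R}}(M)$ is the usual rank over $\mathbb{R}$. For a $0,1$ matrix $M$ of size $n\times m$, the binary rank $\mathrm{rank}_{\mathrm{bin}}(M)$ is the minimal $d$ for which there are $0,1$ matrices $A$ ($n\times d$) and $B$ ($d\times m$) with $M = A\cdot B$ over the integers; equivalently, the minimum number of all-one combinatorial rectangles (submatrices all of whose entries are $1$) needed to partition the ones of $M$. The Boolean rank $\mathrm{rank}_{\mathbb{B}}(M)$ is defined in the same way with Boolean arithmetic ($1+1=1$); equivalently, the minimum number of all-one combinatorial rectangles needed to cover the ones of $M$ (overlaps allowed). An isolation set of $M$ is a set of $1$-entries of $M$ such that no two of them are in the same row or column and no two of them belong to an all-one $2\times 2$ submatrix of $M$; $i(M)$ is the maximum size of an isolation set of $M$. *)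

(* Defs.v *)
From mathcomp Require Import all_boot all_order all_algebra.
From mathcomp Require Import reals.
Set Implicit Arguments.
Unset Strict Implicit.
Unset Printing Implicit Defensive.
Import GRing.Theory.

(* A 0,1 matrix is a matrix over bool; mx01 reads it in a semiring. *)
Definition mx01 (S : pzSemiRingType) (n m : nat) (M : 'M[bool]_(n, m)) :
  'M[S]_(n, m) := map_mx (fun b : bool => (b%:R)%R) M.

Definition bin_factor (n m : nat) (M : 'M[bool]_(n, m)) (d : nat) : bool :=
  [exists A : 'M[bool]_(n, d), exists B : 'M[bool]_(d, m),
    mx01 int M == (mx01 int A *m mx01 int B)%R].

Definition bool_mulmx (n d m : nat) (A : 'M[bool]_(n, d))
    (B : 'M[bool]_(d, m)) : 'M[bool]_(n, m) :=
  (\matrix_(i, j) \big[orb/false]_(k < d) (A i k && B k j))%R.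

Definition bool_factor (n m : nat) (M : 'M[bool]_(n, m)) (d : nat) : bool :=
  [exists A : 'M[bool]_(n, d), exists B : 'M[bool]_(d, m),
    M == bool_mulmx A B].

Lemma bin_factor_ex (n m : nat) (M : 'M[bool]_(n, m)) :
  exists d, bin_factor M d.
Proof.
exists n; apply/existsP; exists (\matrix_(i, j) (i == j))%R.
apply/existsP; exists M; apply/eqP.
have -> : mx01 int (\matrix_(i < n, j < n) (i == j))%R = (1%:M)%R.
  by apply/matrixP => i j; rewrite !mxE.
by rewrite mul1mx.
Qed.

Lemma bool_factor_ex (n m : nat) (M : 'M[bool]_(n, m)) :
  exists d, bool_factor M d.
Proof.
exists n; apply/existsP; exists (\matrix_(i, j) (i == j))%R.
apply/existsP; exists M; apply/eqP/matrixP => i j; rewrite mxE.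
rewrite (bigD1 i) //= mxE eqxx /= big1 ?orbF // => k /negbTE.
by rewrite mxE eq_sym => ->.
Qed.

Definition rank_bin (n m : nat) (M : 'M[bool]_(n, m)) : nat :=
  ex_minn (bin_factor_ex M).

Definition rank_bool (n m : nat) (M : 'M[bool]_(n, m)) : nat :=
  ex_minn (bool_factor_ex M).

(* A 2 x 2 submatrix is given by a set I of two rows and a set J of two
   columns. *)
Definition in_ones_2x2 (n m : nat) (M : 'M[bool]_(n, m))
    (p q : 'I_n * 'I_m) : bool :=
  [exists I : {set 'I_n}, exists J : {set 'I_m},
    [&& #|I| == 2, #|J| == 2, p \in setX I J, q \in setX I J
      & [forall i in I, forall j in J, M i j]]].

Definition isolation_set (n m : nat) (M : 'M[bool]_(n, m))
    (S : {set 'I_n * 'I_m}) : bool :=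
  [forall p in S, M p.1 p.2] &&
  [forall p in S, forall q in S, (p != q) ==>
    [&& p.1 != q.1, p.2 != q.2 & ~~ in_ones_2x2 M p q]].

Definition isolation_number (n m : nat) (M : 'M[bool]_(n, m)) : nat :=
  \max_(S : {set 'I_n * 'I_m} | isolation_set M S) #|S|.

(* The representative kept from each class of identical rows is the first one.
   Computing the kept rows and the kept columns both from M itself is harmless:
   deleting zero or duplicate columns changes neither which rows are zero nor
   which rows are identical, and conversely. *)
Definition kernel_rows (n m : nat) (M : 'M[bool]_(n, m)) : {set 'I_n} :=
  [set i | [exists j, M i j] &&
           [forall i' : 'I_n, (i' < i) ==> (row i' M != row i M)]].

Definition kernel_cols (n m : nat) (M : 'M[bool]_(n, m)) : {set 'I_m} :=
  [set j | [exists i, M i j] &&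
           [forall j' : 'I_m, (j' < j) ==> (col j' M != col j M)]].

Definition kernel (n m : nat) (M : 'M[bool]_(n, m)) :
    'M[bool]_(#|kernel_rows M|, #|kernel_cols M|) :=
  mxsub (fun i : 'I_#|kernel_rows M| => enum_val i)
        (fun j : 'I_#|kernel_cols M| => enum_val j) M.

Definition contains_upto_perm (n m p q : nat) (K : 'M[bool]_(n, m))
    (C : 'M[bool]_(p, q)) : Prop :=
  exists (f : 'I_p -> 'I_n) (g : 'I_q -> 'I_m),
    [/\ injective f, injective g & C = mxsub f g K].

(* The sizes of the two matrices are not required to be convertible, so
   permutations are given as bijections of index sets. *)
Definition equal_upto_perm (n m p q : nat) (K : 'M[bool]_(n, m))
    (C : 'M[bool]_(p, q)) : Prop :=
  exists (f : 'I_p -> 'I_n) (g : 'I_q -> 'I_m),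
    [/\ bijective f, bijective g & C = mxsub f g K].

Definition mx_of_rows (n m : nat) (s : seq (seq nat)) : 'M[bool]_(n, m) :=
  (\matrix_(i, j) (nth 0%N (nth [::] s i) j == 1%N))%R.

Definition C4 : 'M[bool]_(4, 4) :=
  mx_of_rows 4 4 [:: [:: 1; 1; 0; 0];
                     [:: 0; 1; 1; 0];
                     [:: 0; 0; 1; 1];
                     [:: 1; 0; 0; 1]].

Definition A7 : 'M[bool]_(3, 3) :=
  mx_of_rows 3 3 [:: [:: 1; 1; 0];
                     [:: 0; 1; 1];
                     [:: 1; 1; 1]].

(* Main.v *)
Require Import Defs.
From mathcomp Require Import all_boot all_order all_algebra.
From mathcomp Require Import reals.
From mathcomp Require Import ring zify.
Set Implicit Arguments.
Unset Strict Implicit.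
Unset Printing Implicit Defensive.
Import Order.TTheory GRing.Theory Num.Theory.

(** The three combinatorial parameters always satisfy
    isolation number <= Boolean rank <= binary rank, and the binary rank is at
    least the real rank, here 3. So everything follows from lower bounds on the
    isolation number and upper bounds on the binary rank. Both can be proved
    for the kernel [K] of [M], which has the same real rank: [M] is obtained
    from [K] by repeating and inserting rows and columns ([kernel_blowup]).

    Fix three rows of [K] and three columns of [K] that carry an invertible
    3 x 3 submatrix. Every column of [K] is then given by its pattern on the
    three rows, a nonzero point of the cube {0,1}^3, with distinct columns
    giving distinct points, and every row of [K] is given by a linear
    functional [w] on R^3 that takes the values 0 and 1 at these points. If
    [K] has at least four columns then, with the origin, [w] is 0-1 valued at
    five or more points of the cube. Each direction splits the cube into four
    parallel edges, so some edge of each direction has both ends among these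
    points, and each coordinate of [w] is the difference of two 0-1 values,
    that is -1, 0 or 1. Inspecting the 27 such functionals
    ([small_functional]) leaves zero, the three coordinates, which are the
    three rows fixed above, and twelve proper functionals: x + y, x - y and
    x + y - z up to a permutation of the coordinates.

    Size of the kernel. Each proper functional leaves {0,1} at exactly two
    points of the cube, and different ones do so at different pairs of points.
    So with two further rows at most five points, hence at most four columns,
    survive ([reduced_small]).

    Upper bound on the binary rank. If [K] has at most three rows or columns
    there is nothing to do; otherwise, up to transposition, it has exactly four
    rows. By the shape of the proper functional, the fourth row makes one row
    the sum of two others, or makes two rows have the same sum as the other two:
    a + b = c + d. In the first case the other three rows generate [K]. In the
    second case the columns of [K], as sets of rows, are among {a,b,c,d} and
    the four pairs {a,c}, {a,d}, {b,c}, {b,d}. If all four pairs occur they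
    form [C4]; if one is missing then a row is contained in another one and
    three rectangles suffice ([rank_bin_le3_or_C4]).

    Lower bound on the isolation number. The diagonal of [C4] is an isolation
    set of size 4. A 3 x 3 zero-one matrix of rank 3 has an isolation set of
    size 3 unless it is [A7] up to permutation, and adding to [A7] any nonzero
    row different from its own, hence by transposition any such column,
    creates one. So only the kernel [A7] itself has isolation number 2
    ([isolated_or_A7]). *)

(** * Factorizations and isolation sets *)

Lemma bin_factorP (n m : nat) (M : 'M[bool]_(n, m)) (d : nat) :
  reflect (exists (A : 'M[bool]_(n, d)) (B : 'M[bool]_(d, m)),
             forall i j, M i j = \sum_k A i k * B k j :> nat)
          (bin_factor M d).
Proof.
have natE (A : 'M[bool]_(n, d)) (B : 'M[bool]_(d, m)) i j :
    ((mx01 int A *m mx01 int B) i j = (\sum_k A i k * B k j)%N%:R)%R.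
  by rewrite mxE natr_sum; apply: eq_bigr => k _; rewrite !mxE natrM.
apply: (iffP existsP) => [[A /existsP[B /eqP/matrixP MAB]]|[A [B MAB]]].
  exists A, B => i j; apply/eqP; have := MAB i j.
  by rewrite natE mxE => /eqP; rewrite eqr_nat.
exists A; apply/existsP; exists B; apply/eqP/matrixP => i j.
by rewrite natE mxE MAB.
Qed.

Lemma bool_factorP (n m : nat) (M : 'M[bool]_(n, m)) (d : nat) :
  reflect (exists (A : 'M[bool]_(n, d)) (B : 'M[bool]_(d, m)),
             forall i j, M i j = [exists k, A i k && B k j])
          (bool_factor M d).
Proof.
have orE (A : 'M[bool]_(n, d)) (B : 'M[bool]_(d, m)) i j :
    bool_mulmx A B i j = [exists k, A i k && B k j].
  by rewrite mxE big_orE.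
apply: (iffP existsP) => [[A /existsP[B /eqP MAB]]|[A [B MAB]]].
  by exists A, B => i j; rewrite MAB orE.
exists A; apply/existsP; exists B; apply/eqP/matrixP => i j.
by rewrite orE MAB.
Qed.

Lemma rank_bin_factor (n m : nat) (M : 'M[bool]_(n, m)) :
  bin_factor M (rank_bin M).
Proof. by rewrite /rank_bin; case: ex_minnP. Qed.

Lemma rank_bin_min (n m : nat) (M : 'M[bool]_(n, m)) (d : nat) :
  bin_factor M d -> rank_bin M <= d.
Proof. by rewrite /rank_bin; case: ex_minnP => r _; apply. Qed.

Lemma rank_bool_factor (n m : nat) (M : 'M[bool]_(n, m)) :
  bool_factor M (rank_bool M).
Proof. by rewrite /rank_bool; case: ex_minnP. Qed.

Lemma rank_bool_min (n m : nat) (M : 'M[bool]_(n, m)) (d : nat) :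
  bool_factor M d -> rank_bool M <= d.
Proof. by rewrite /rank_bool; case: ex_minnP => r _; apply. Qed.

Lemma rank_bool_le_bin (n m : nat) (M : 'M[bool]_(n, m)) :
  rank_bool M <= rank_bin M.
Proof.
apply/rank_bool_min/bool_factorP.
have /bin_factorP[A [B MAB]] := rank_bin_factor M.
exists A, B => i j; apply/idP/existsP => [Mij|[k /andP[Aik Bkj]]].
  apply/existsP; apply: contra_eqT (MAB i j) => /existsPn noAB.
  rewrite Mij big1 // => k _; have := noAB k.
  by case: (A i k); case: (B k j).
by rewrite -[M i j]lt0b MAB (bigD1 k) //= Aik Bkj mul1n add1n.
Qed.

Lemma rank_le_bin (R : numFieldType) (n m : nat) (M : 'M[bool]_(n, m)) :
  \rank (mx01 R M) <= rank_bin M.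
Proof.
have /bin_factorP[A [B MAB]] := rank_bin_factor M.
have -> : mx01 R M = (mx01 R A *m mx01 R B)%R.
  apply/matrixP => i j; rewrite !mxE MAB natr_sum.
  by apply: eq_bigr => k _; rewrite !mxE natrM.
exact: leq_trans (mxrankM_maxl _ _) (rank_leq_col _).
Qed.

Lemma rank_bin_le_rows (n m : nat) (M : 'M[bool]_(n, m)) : rank_bin M <= n.
Proof.
apply/rank_bin_min/bin_factorP; exists (\matrix_(i, k) (i == k))%R, M => i j.
rewrite (bigD1 i) //= mxE eqxx mul1n big1 ?addn0 // => k /negbTE.
by rewrite mxE eq_sym => ->.
Qed.

Lemma rank_bin_tr_le (n m : nat) (M : 'M[bool]_(n, m)) :
  rank_bin M^T <= rank_bin M.
Proof.
apply/rank_bin_min/bin_factorP.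
have /bin_factorP[A [B MAB]] := rank_bin_factor M.
exists B^T%R, A^T%R => i j; rewrite mxE MAB.
by apply: eq_bigr => k _; rewrite !mxE mulnC.
Qed.

Lemma rank_bin_tr (n m : nat) (M : 'M[bool]_(n, m)) :
  rank_bin M^T = rank_bin M.
Proof.
by apply/eqP; rewrite eqn_leq rank_bin_tr_le -{1}[M]trmxK rank_bin_tr_le.
Qed.

(** Indexed form of an isolation set: injectivity of [f] and [g] follows from
    the condition on pairs. *)
Definition isolated (k n m : nat) (M : 'M[bool]_(n, m))
    (f : 'I_k -> 'I_n) (g : 'I_k -> 'I_m) : Prop :=
  (forall x, M (f x) (g x)) /\
  (forall x y, x != y -> ~~ (M (f x) (g y) && M (f y) (g x))).

Lemma isolated_tr (k n m : nat) (M : 'M[bool]_(n, m))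
    (f : 'I_k -> 'I_n) (g : 'I_k -> 'I_m) :
  isolated M^T g f -> isolated M f g.
Proof.
move=> [Mfg iso]; split=> [x|x y xy]; first by have := Mfg x; rewrite mxE.
by have := iso x y xy; rewrite !mxE andbC.
Qed.

Lemma isolated_le (k n m : nat) (M : 'M[bool]_(n, m))
    (f : 'I_k -> 'I_n) (g : 'I_k -> 'I_m) :
  isolated M f g -> k <= isolation_number M.
Proof.
move=> [Mfg iso].
have fI : injective f.
  move=> x y fxy; apply/eqP; apply: contraT => /iso.
  by rewrite fxy Mfg -fxy Mfg.
have gI : injective g.
  move=> x y gxy; apply/eqP; apply: contraT => /iso.
  by rewrite -gxy Mfg gxy Mfg.
pose e x := (f x, g x).
have eI : injective e by move=> x y [/fI].
have <- : #|e @: setT| = k by rewrite card_imset // cardsT card_ord.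
apply: (leq_bigmax_cond (P := isolation_set M)
  (F := fun S => #|pred_of_set S|)).
apply/andP; split; first by apply/forall_inP => _ /imsetP[x _ ->]; apply: Mfg.
apply/forall_inP => _ /imsetP[x _ ->]; apply/forall_inP => _ /imsetP[y _ ->].
apply/implyP; rewrite (inj_eq eI) => xy /=.
rewrite (inj_eq fI) (inj_eq gI) xy /=; apply: contra (iso x y xy).
case/existsP=> I /existsP[J /and5P[_ _ /setXP[/= fxI gxJ] /setXP[/= fyI gyJ]]].
by move=> /forall_inP ones; rewrite !(forall_inP (ones _ _)).
Qed.

(** Sending each entry of an isolation set to a rectangle of a Boolean
    factorization that covers it is injective. *)
Lemma isolation_le_bool (n m : nat) (M : 'M[bool]_(n, m)) :
  isolation_number M <= rank_bool M.
Proof.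
apply/bigmax_leqP => S /andP[/forall_inP ones /forall_inP iso].
have /bool_factorP[A [B MAB]] := rank_bool_factor M.
have [S0|[p0 p0S]] := set_0Vmem S; first by rewrite S0 cards0.
have /existsP[k0 _] : [exists k, A p0.1 k && B k p0.2].
  by rewrite -MAB ones.
pose k p := odflt k0 [pick k | A p.1 k && B k p.2].
have kP p : p \in S -> A p.1 (k p) && B (k p) p.2.
  rewrite /k => /ones; rewrite MAB => /existsP[l Al]; case: pickP => //.
  by move/(_ l); rewrite Al.
rewrite -[X in _ <= X]card_ord -(card_in_imset (f := k)) ?max_card //.
(* Two isolated ones in the same all-one rectangle would span a 2 x 2 one. *)
move=> p q pS qS kpq; apply/eqP; apply: contraT => pq.
have /forall_inP/(_ q qS)/implyP/(_ pq)/and3P[p1q1 p2q2 /negP[]] := iso p pS.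
have /andP[Ap Bp] := kP p pS; have /andP[Aq Bq] := kP q qS.
apply/existsP; exists [set p.1; q.1]; apply/existsP; exists [set p.2; q.2].
rewrite !cards2 p1q1 p2q2 !inE !eqxx !orbT /=.
apply/forall_inP => i ip; apply/forall_inP => j jp.
rewrite MAB; apply/existsP; exists (k p).
by move: ip jp; rewrite !inE => /orP[]/eqP-> /orP[]/eqP->;
  rewrite ?Ap ?Bp ?kpq ?Aq ?Bq.
Qed.

(** * Reduction to the kernel *)

Definition distinct_rows (n m : nat) (M : 'M[bool]_(n, m)) : Prop :=
  forall i i', (forall j, M i j = M i' j) -> i = i'.

Definition reduced_rows (n m : nat) (M : 'M[bool]_(n, m)) : Prop :=
  (forall i, exists j, M i j) /\ distinct_rows M.

(** [M] is obtained from [K] by repeating rows and columns and inserting zero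
    ones: [phi] and [psi] tell which row and column of [K], if any, is
    copied. *)
Definition blowup (n m p q : nat) (M : 'M[bool]_(n, m)) (K : 'M[bool]_(p, q))
    (phi : 'I_n -> option 'I_p) (psi : 'I_m -> option 'I_q) : Prop :=
  forall i j, M i j = oapp (fun x => oapp (K x) false (psi j)) false (phi i).

Lemma rank_bin_blowup (n m p q : nat) (M : 'M[bool]_(n, m))
    (K : 'M[bool]_(p, q)) phi psi :
  blowup M K phi psi -> rank_bin M <= rank_bin K.
Proof.
move=> MK; apply/rank_bin_min/bin_factorP.
have /bin_factorP[A [B KAB]] := rank_bin_factor K.
exists (\matrix_(i, k) oapp (A^~ k) false (phi i))%R.
exists (\matrix_(k, j) oapp (B k) false (psi j))%R => i j.
rewrite MK; under eq_bigr do rewrite !mxE.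
case: (phi i) (psi j) => [x|] [y|] //=;
  by rewrite big1 // => k _; rewrite muln0.
Qed.

Lemma rank_bool_blowup (n m p q : nat) (M : 'M[bool]_(n, m))
    (K : 'M[bool]_(p, q)) phi psi :
  blowup M K phi psi -> rank_bool M <= rank_bool K.
Proof.
move=> MK; apply/rank_bool_min/bool_factorP.
have /bool_factorP[A [B KAB]] := rank_bool_factor K.
exists (\matrix_(i, k) oapp (A^~ k) false (phi i))%R.
exists (\matrix_(k, j) oapp (B k) false (psi j))%R => i j.
rewrite MK; under eq_existsb do rewrite !mxE.
case: (phi i) (psi j) => [x|] [y|] //=;
  by apply/esym/existsP => -[k]; rewrite ?andbF.
Qed.

Lemma rank_blowup (F : fieldType) (n m p q : nat) (M : 'M[bool]_(n, m))
    (K : 'M[bool]_(p, q)) phi psi :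
  blowup M K phi psi -> \rank (mx01 F M) <= \rank (mx01 F K).
Proof.
move=> MK.
pose P := (\matrix_(i < n, x < p) (phi i == Some x)%:R : 'M[F]_(n, p))%R.
pose Q := (\matrix_(y < q, j < m) (psi j == Some y)%:R : 'M[F]_(q, m))%R.
suff -> : mx01 F M = (P *m mx01 F K *m Q)%R.
  exact: leq_trans (mxrankM_maxl _ _) (mxrankM_maxr _ _).
apply/matrixP => i j; rewrite !mxE MK; case psij: (psi j) => [y|]; last first.
  case: (phi i) => [x|] /=;
    by rewrite big1 // => y _; rewrite !mxE psij /= mulr0.
rewrite (bigD1 y) //= big1 => [|y' /negbTE y'y]; last first.
  by rewrite !mxE psij (inj_eq (@Some_inj _)) eq_sym y'y /= mulr0.
rewrite addr0 !mxE psij eqxx mulr1; case phii: (phi i) => [x|]; last first.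
  by rewrite big1 // => x _; rewrite mxE phii /= mul0r.
rewrite (bigD1 x) //= big1 => [|x' /negbTE x'x]; last first.
  by rewrite !mxE phii (inj_eq (@Some_inj _)) eq_sym x'x /= mul0r.
by rewrite !mxE phii eqxx mul1r addr0.
Qed.

Lemma kernel_rowP (n m : nat) (M : 'M[bool]_(n, m)) (i : 'I_n) :
  (exists j, M i j) ->
  exists x : 'I_#|kernel_rows M|, forall j, M (enum_val x) j = M i j.
Proof.
move=> [j Mij].
have [i' /eqP rowi' min_i'] : exists2 i' : 'I_n, row i' M == row i M &
    forall k : 'I_n, row k M == row i M -> i' <= k.
  by case: (@arg_minnP _ i (fun k => row k M == row i M) (@nat_of_ord n)
           (eqxx _)) => i' ? ?; exists i'.
have M_i' j' : M i' j' = M i j'.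
  by have /rowP/(_ j') := rowi'; rewrite !mxE.
have i'K : i' \in kernel_rows M.
  rewrite inE; apply/andP; split.
    by apply/existsP; exists j; rewrite M_i'.
  apply/forall_inP => k ki'; apply: contraTN ki'.
  by rewrite rowi' -leqNgt => /min_i'.
by exists (enum_rank_in i'K i') => j'; rewrite enum_rankK_in.
Qed.

Lemma kernel_cols_tr (n m : nat) (M : 'M[bool]_(n, m)) :
  kernel_cols M = kernel_rows M^T.
Proof.
apply/setP => j; rewrite !inE; congr andb.
  by apply: eq_existsb => i; rewrite mxE.
by apply: eq_forallb => j'; rewrite -!tr_col (inj_eq trmx_inj).
Qed.

Lemma kernel_colP (n m : nat) (M : 'M[bool]_(n, m)) (j : 'I_m) :
  (exists i, M i j) ->
  exists y : 'I_#|kernel_cols M|, forall i, M i (enum_val y) = M i j.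
Proof.
move=> [i Mij]; rewrite kernel_cols_tr.
have [|y My] := @kernel_rowP _ _ M^T j; first by exists i; rewrite mxE.
by exists y => i'; have := My i'; rewrite !mxE.
Qed.

Lemma kernelE (n m : nat) (M : 'M[bool]_(n, m)) x y :
  kernel M x y = M (enum_val x) (enum_val y).
Proof. by rewrite mxE. Qed.

Lemma kernel_blowup (n m : nat) (M : 'M[bool]_(n, m)) :
  exists phi psi, blowup M (kernel M) phi psi.
Proof.
have /fin_all_exists[phi phiP] i : exists o : option 'I_#|kernel_rows M|,
    forall j, M i j = oapp (fun x => M (enum_val x) j) false o.
  case: (boolP [exists j, M i j]) => [/existsP/kernel_rowP[x Mx]|/existsPn M0].
    by exists (Some x); move=> j; rewrite /= Mx.
  by exists None; move=> j; apply/negbTE/M0.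
have /fin_all_exists[psi psiP] j : exists o : option 'I_#|kernel_cols M|,
    forall i, M i j = oapp (fun y => M i (enum_val y)) false o.
  case: (boolP [exists i, M i j]) => [/existsP/kernel_colP[y My]|/existsPn M0].
    by exists (Some y); move=> i; rewrite /= My.
  by exists None; move=> i; apply/negbTE/M0.
exists phi, psi => i j; rewrite phiP; case: (phi i) => //= x.
by rewrite psiP; case: (psi j) => //= y; rewrite kernelE.
Qed.

(** Stated for arbitrary sets [A] and [B] so that it applies to [M] and to its
    transpose. Deleting columns keeps distinct rows distinct because a column
    on which two rows differ has a one, hence has a copy among those kept. *)
Lemma mxsub_reduced_rows (n m : nat) (M : 'M[bool]_(n, m))
    (A : {set 'I_n}) (B : {set 'I_m}) :
  A = kernel_rows M -> B = kernel_cols M ->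
  reduced_rows (mxsub (fun x : 'I_#|A| => enum_val x)
                      (fun y : 'I_#|B| => enum_val y) M).
Proof.
move=> -> ->; rewrite -/(kernel M); split=> [x|x x' Kxx'].
  have := enum_valP x; rewrite inE => /andP[/existsP[j Mxj] _].
  have [|y My] := @kernel_colP _ _ M j; first by exists (enum_val x).
  by exists y; rewrite kernelE My.
have rowE : row (enum_val x) M = row (enum_val x') M.
  apply/rowP => j; rewrite !mxE; apply/idP/idP => Mj.
    have [|y My] := @kernel_colP _ _ M j; first by exists (enum_val x).
    by rewrite -My -kernelE -Kxx' kernelE My.
  have [|y My] := @kernel_colP _ _ M j; first by exists (enum_val x').
  by rewrite -My -kernelE Kxx' kernelE My.
have := enum_valP x; have := enum_valP x'; rewrite !inE.
move=> /andP[_ /forallP x'_first] /andP[_ /forallP x_first].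
apply: enum_val_inj.
case: (ltngtP (nat_of_ord (enum_val x)) (nat_of_ord (enum_val x'))) => lt.
- by have := implyP (x'_first _) lt; rewrite rowE eqxx.
- by have := implyP (x_first _) lt; rewrite rowE eqxx.
- exact: val_inj lt.
Qed.

Lemma kernel_reduced_rows (n m : nat) (M : 'M[bool]_(n, m)) :
  reduced_rows (kernel M).
Proof. exact: mxsub_reduced_rows. Qed.

Lemma kernel_reduced_cols (n m : nat) (M : 'M[bool]_(n, m)) :
  reduced_rows (kernel M)^T.
Proof.
rewrite trmx_mxsub; apply: mxsub_reduced_rows; first exact: kernel_cols_tr.
by rewrite kernel_cols_tr trmxK.
Qed.

Lemma rank_kernel (F : fieldType) (n m : nat) (M : 'M[bool]_(n, m)) :
  \rank (mx01 F (kernel M)) = \rank (mx01 F M).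
Proof.
have [phi [psi MK]] := kernel_blowup M.
apply/eqP; rewrite eqn_leq (rank_blowup F MK) andbT.
apply: (@rank_blowup _ _ _ _ _ _ _ (fun x => Some (enum_val x))
          (fun y => Some (enum_val y))).
by move=> x y; rewrite kernelE.
Qed.

(** * Three independent rows and columns *)

Definition triple (S : Type) : Type := (S * S * S)%type.

Definition i0 : 'I_3 := ord0.
Definition i1 : 'I_3 := lift ord0 ord0.
Definition i2 : 'I_3 := lift ord0 (lift ord0 ord0).

Lemma ord3P (P : 'I_3 -> Prop) : P i0 -> P i1 -> P i2 -> forall x, P x.
Proof.
move=> P0 P1 P2 [[|[|[|//]]] lt]; [move: P0|move: P1|move: P2];
  by congr P; apply: val_inj.
Qed.

Definition dot (S : pzRingType) (w : triple S) (q : triple bool) : S :=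
  (w.1.1 * q.1.1%:R + w.1.2 * q.1.2%:R + w.2 * q.2%:R)%R.

Definition pattern (n m : nat) (K : 'M[bool]_(n, m)) (f : 'I_3 -> 'I_n)
    (j : 'I_m) : triple bool :=
  (K (f i0) j, K (f i1) j, K (f i2) j).

Definition row_frame (S : pzRingType) (n m : nat) (K : 'M[bool]_(n, m))
    (f : 'I_3 -> 'I_n) (g : 'I_3 -> 'I_m) : Prop :=
  (forall i, exists w : triple S, forall j,
     (K i j)%:R%R = dot w (pattern K f j)) /\
  (forall w : triple S, (forall y, dot w (pattern K f (g y)) = 0%R) ->
     w = (0, 0, 0)%R).

(** The same rows and columns serve for [K] and for its transpose, so that
    results on rows apply to columns. *)
Definition frame (S : pzRingType) (n m : nat) (K : 'M[bool]_(n, m))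
    (f : 'I_3 -> 'I_n) (g : 'I_3 -> 'I_m) : Prop :=
  row_frame S K f g /\ row_frame S K^T g f.

Lemma row_basis (F : fieldType) (n m r : nat) (A : 'M[F]_(n, m)) :
  \rank A = r -> exists f : 'I_r -> 'I_n, \rank (rowsub f A) = r.
Proof.
move=> <-; exists (maxrankfun A); apply/eqP; exact: maxrowsub_free.
Qed.

(** The rows [f] have a submatrix of rank 3, hence span the whole row space
    of [K]. *)
Lemma row_frame_of_rank (F : fieldType) (n m : nat) (K : 'M[bool]_(n, m))
    (f : 'I_3 -> 'I_n) (g : 'I_3 -> 'I_m) :
  \rank (mx01 F K) = 3 -> \rank (mxsub f g (mx01 F K)) = 3 ->
  row_frame F K f g.
Proof.
set A := mx01 F K; set N := mxsub f g A => rankA rankN.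
have dotE (w : triple F) j : dot w (pattern K f j) =
    ((\row_x nth 0 [:: w.1.1; w.1.2; w.2] x)%R *m rowsub f A)%R 0%R j.
  by rewrite mxE !big_ord_recl big_ord0 addr0 !mxE /= /dot addrA.
split=> [i|w w0].
  have sAf : (A <= rowsub f A)%MS.
    have rank_ge3 : 3 <= \rank (rowsub f A).
      rewrite -{1}rankN.
      have -> : N = (rowsub g (rowsub f A)^T)^T%R.
        by apply/matrixP => x y; rewrite !mxE.
      by rewrite mxrank_tr -[leqRHS]mxrank_tr mxrankS ?rowsub_sub.
    rewrite -(mxrank_leqif_sup (rowsub_sub f A)) eqn_leq mxrankS ?rowsub_sub //.
    by rewrite rankA.
  have /submxP[D rowA] := submx_trans (row_sub i A) sAf.
  exists (D 0 i0, D 0 i1, D 0 i2)%R => j.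
  have /rowP/(_ j) := rowA; rewrite !mxE => ->; rewrite dotE mxE.
  by apply: eq_bigr => k _; rewrite !mxE; congr (_ * _)%R; elim/ord3P: k.
have freeN : row_free N by rewrite /row_free rankN.
have /rowP v0 : (\row_x nth 0 [:: w.1.1; w.1.2; w.2] x)%R = 0%R :> 'rV[F]_3.
  apply: (row_free_inj freeN); rewrite mul0mx; apply/rowP => y.
  rewrite [RHS]mxE; apply: etrans (w0 y); rewrite dotE [LHS]mxE [RHS]mxE.
  by apply: eq_bigr => k _; congr (_ * _)%R; rewrite !mxE.
case: w {w0} v0 => [[a b] c] v0.
by have := v0 i0; have := v0 i1; have := v0 i2; rewrite !mxE /= => -> -> ->.
Qed.

Lemma frame_exists (F : fieldType) (n m : nat) (K : 'M[bool]_(n, m)) :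
  \rank (mx01 F K) = 3 -> exists f g, frame F K f g.
Proof.
move=> rankK.
have [f rankf] := row_basis rankK.
have [g rankg] : exists g : 'I_3 -> 'I_m,
    \rank (rowsub g (rowsub f (mx01 F K))^T%R) = 3.
  by apply: row_basis; rewrite mxrank_tr.
have trK : mx01 F K^T = (mx01 F K)^T%R by rewrite /mx01 map_trmx.
have rankN : \rank (mxsub f g (mx01 F K)) = 3.
  apply: etrans rankg; rewrite -[LHS]mxrank_tr; congr (\rank _).
  by apply/matrixP => i j; rewrite !mxE.
exists f, g; split; apply: row_frame_of_rank => //.
  by rewrite trK mxrank_tr.
by rewrite trK -trmx_mxsub mxrank_tr.
Qed.

Lemma frame_tr (S : pzRingType) (n m : nat) (K : 'M[bool]_(n, m)) f g :
  frame S K f g -> frame S K^T g f.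
Proof. by case=> ? ?; split; rewrite ?trmxK. Qed.

(** * Functionals that are 0-1 valued on many points of the cube *)

Definition cube : seq (triple bool) :=
  let bits := [:: false; true] in
  [seq (ab, c) | ab <- [seq (a, b) | a <- bits, b <- bits], c <- bits].

Lemma mem_cube (q : triple bool) : q \in cube.
Proof. by case: q => [[[] []] []]. Qed.

Definition is01 (S : pzRingType) (x : S) : bool := (x == 0%R) || (x == 1%R).

Definition coordinate_functionals : seq (triple int) :=
  [:: (0, 0, 0); (1, 0, 0); (0, 1, 0); (0, 0, 1)]%R.

Definition proper_functionals : seq (triple int) :=
  [:: (1, 1, 0); (1, 0, 1); (0, 1, 1);
      (1, -1, 0); (-1, 1, 0); (1, 0, -1); (-1, 0, 1); (0, 1, -1); (0, -1, 1);
      (1, 1, -1); (1, -1, 1); (-1, 1, 1)]%R.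

(** The cube has only four edges in each direction, so among five points two
    are the ends of the same edge. *)
Lemma cube_pigeonhole (t : pred (triple bool)) :
  4 < count t cube ->
  [/\ exists b c, t (false, b, c) && t (true, b, c),
      exists a c, t (a, false, c) && t (a, true, c) &
      exists a b, t (a, b, false) && t (a, b, true)].
Proof.
have ex2P (u : bool -> bool -> bool) :
    [|| u false false, u false true, u true false | u true true] ->
    exists a b, u a b.
  by case/or4P => ?; [exists false, false|exists false, true|
                      exists true, false|exists true, true].
move=> t5; split; apply: ex2P; move: t5; rewrite /cube /=;
  do 8![case: (t _)] => //.
Qed.

Lemma dot_intr (R : pzRingType) (v : triple int) (q : triple bool) :
  dot (v.1.1%:~R, v.1.2%:~R, v.2%:~R)%R q = (dot v q)%:~R%R :> R.
Proof. by rewrite /dot !rmorphD !rmorphM !rmorph_nat. Qed.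

(** Once the coordinates of [w] are known to be -1, 0 or 1, the 16 functionals
    in the list are found among 27 by counting. Functionals with half-integral
    coefficients do occur as rows of a matrix of rank 3, but they are 0-1
    valued at too few points. *)
Lemma small_functional (R : numDomainType) (w : triple R) :
  4 < count (fun q => is01 (dot w q)) cube ->
  exists2 v, v \in coordinate_functionals ++ proper_functionals &
    forall q, dot w q = (dot v q)%:~R%R.
Proof.
move=> w5; have [] := cube_pigeonhole w5.
have diffE (x y z : R) : is01 x -> is01 y -> z = (y - x)%R ->
    exists2 k : int, k \in [:: -1; 0; 1]%R & z = k%:~R%R.
  case/orP=> /eqP-> /orP[]/eqP-> ->; [exists 0%R|exists 1%R|exists (-1)%R|
    exists 0%R] => //; by rewrite ?subrr ?subr0 ?sub0r ?rmorphN.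
move=> [b [c /andP[w1 w1']]] [a [d /andP[w2 w2']]] [e [h /andP[w3 w3']]].
have [|k1 k1P w1E] := diffE _ _ w.1.1 w1 w1'; first by rewrite /dot /=; ring.
have [|k2 k2P w2E] := diffE _ _ w.1.2 w2 w2'; first by rewrite /dot /=; ring.
have [|k3 k3P w3E] := diffE _ _ w.2 w3 w3'; first by rewrite /dot /=; ring.
have wE q : dot w q = (dot (k1, k2, k3) q)%:~R%R.
  by rewrite -dot_intr /= -w1E -w2E -w3E; case: (w) => [[]].
exists (k1, k2, k3) => //.
have {w5} : 4 < count (fun q => is01 (dot (k1, k2, k3) q)) cube.
  apply: leq_trans w5 _; apply/eq_leq/eq_count => q.
  by rewrite /is01 wE intr_eq0 -(eqr_int R _ 1).
move: k1P k2P k3P; rewrite !inE.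
by do 3![case/or3P => /eqP->].
Qed.

(** Each functional leaves {0,1} at two points of the cube, and these pairs
    are different, so at least three points are lost. *)
Lemma proper_functionals_disagree :
  all (fun v => all (fun v' => (v != v') ==>
    (count (fun q => is01 (dot v q) && is01 (dot v' q)) cube <= 5))
    proper_functionals) proper_functionals.
Proof. by vm_compute. Qed.

(** * Independent triples of bit patterns *)

Definition dependent (a b c : triple bool) (w : triple int) : bool :=
  [&& dot w (a.1.1, b.1.1, c.1.1) == 0,
      dot w (a.1.2, b.1.2, c.1.2) == 0 &
      dot w (a.2, b.2, c.2) == 0]%R.

(** Absence of the shortest linear relations: a zero vector, two equal vectors,
    a vector that is the sum of two others. This follows from linear
    independence, can be evaluated, and suffices to find an isolation set or
    [A7]. *)
Definition independent (a b c : triple bool) : bool :=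
  all (fun w => ~~ dependent a b c w)
    [:: (1, 0, 0); (0, 1, 0); (0, 0, 1);
        (1, -1, 0); (1, 0, -1); (0, 1, -1);
        (1, -1, -1); (-1, 1, -1); (-1, -1, 1)]%R.

Definition isolated3 (x y z : triple bool) : bool :=
  [&& x.1.1, y.1.2, z.2, ~~ (x.1.2 && y.1.1), ~~ (x.2 && z.1.1) &
      ~~ (y.2 && z.1.2)].

Definition bit (q : triple bool) (y : 'I_3) : bool :=
  nth false [:: q.1.1; q.1.2; q.2] y.

Definition is_A7 (x y z : triple bool) (s t u : 'I_3) : bool :=
  [&& bit x s, bit x t, ~~ bit x u, ~~ bit y s, bit y t, bit y u,
      bit z s, bit z t & bit z u].

(** All orders of the rows are tried, so the columns can be kept in place. *)
Definition has_isolated3 (s : seq (triple bool)) : bool :=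
  has (fun x => has (fun y => has (isolated3 x y) s) s) s.

Definition has_A7 (s : seq (triple bool)) : bool :=
  let o := [:: i0; i1; i2] in
  has (fun x => has (fun y => has (fun z =>
    has (fun i => has (fun j => has (is_A7 x y z i j) o) o) o) s) s) s.

Lemma independent_isolated_or_A7 :
  all (fun a => all (fun b => all (fun c => independent a b c ==>
    uniq [:: a; b; c] && (has_isolated3 [:: a; b; c] || has_A7 [:: a; b; c]))
  cube) cube) cube.
Proof. by vm_compute. Qed.

Lemma independent_extra_isolated :
  all (fun a => all (fun b => all (fun c => independent a b c ==>
    all (fun p => (p \notin [:: (false, false, false); a; b; c]) ==>
      has_isolated3 [:: a; b; c; p])
  cube) cube) cube) cube.
Proof. by vm_compute. Qed.

(** * Rows of a reduced matrix of rank 3 *)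

Lemma frame_independent (R : numDomainType) (n m : nat)
    (K : 'M[bool]_(n, m)) f g :
  row_frame R K f g ->
  let r x := pattern K^T g (f x) in independent (r i0) (r i1) (r i2).
Proof.
case=> _ indep /=; rewrite /independent.
have dep0 w : dependent (pattern K^T g (f i0)) (pattern K^T g (f i1))
    (pattern K^T g (f i2)) w -> w = (0, 0, 0)%R.
  case/and3P; rewrite /= !mxE => /eqP d0 /eqP d1 /eqP d2.
  have /eqP : (w.1.1%:~R, w.1.2%:~R, w.2%:~R)%R = (0, 0, 0)%R :> triple R.
    by apply: indep; apply: ord3P; rewrite dot_intr /pattern ?d0 ?d1 ?d2.
  rewrite !xpair_eqE !intr_eq0; case: w {d0 d1 d2} => [[a b] c] /=.
  by case/andP=> /andP[/eqP-> /eqP->] /eqP->.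
apply/allP => w wW; apply/negP => /dep0 w0.
by rewrite w0 in wW.
Qed.

Lemma natr_bool_inj (R : numDomainType) (a b : bool) :
  a%:R%R = b%:R%R :> R -> a = b.
Proof. by move/eqP; rewrite eqr_nat; case: a; case: b. Qed.

(** Since the rows [f] span all rows, a column is determined by its pattern
    on them. *)
Lemma pattern_inj (R : numDomainType) (n m : nat) (K : 'M[bool]_(n, m)) f g :
  row_frame R K f g -> reduced_rows K^T -> injective (pattern K f).
Proof.
move=> [span _] [_ Kdist] j j' pjj'; apply: Kdist => i; rewrite !mxE.
have [w wE] := span i.
by apply: (natr_bool_inj (R := R)); rewrite !wE pjj'.
Qed.

Lemma pattern_neq0 (R : numDomainType) (n m : nat) (K : 'M[bool]_(n, m)) f g j :
  row_frame R K f g -> reduced_rows K^T ->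
  pattern K f j != (false, false, false).
Proof.
move=> [span _] [Kneq0 _]; apply/eqP => pj0.
have [i] := Kneq0 j; rewrite mxE => Kij; have [w /(_ j)] := span i.
by rewrite pj0 Kij /dot /= !mulr0 !addr0 => /eqP; rewrite oner_eq0.
Qed.

(** The patterns of the [m] columns are distinct and nonzero; the origin is
    one more point. *)
Lemma count_patterns (R : numDomainType) (n m : nat) (K : 'M[bool]_(n, m)) f g
    (t : pred (triple bool)) :
  row_frame R K f g -> reduced_rows K^T ->
  t (false, false, false) -> (forall j, t (pattern K f j)) ->
  m < count t cube.
Proof.
move=> rf Kr t0 tK.
pose s := (false, false, false) :: [seq pattern K f j | j <- enum 'I_m].
have <- : size s = m.+1 by rewrite /= size_map size_enum_ord.
rewrite -size_filter; apply: uniq_leq_size.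
  rewrite /= (map_inj_uniq (pattern_inj rf Kr)) enum_uniq andbT.
  by apply/mapP => -[j _ /esym/eqP]; apply/negP/(pattern_neq0 j rf Kr).
move=> q; rewrite mem_filter mem_cube andbT inE => /predU1P[->//|].
by case/mapP => j _ ->.
Qed.

(** The coordinate functionals are excluded because they give the rows [f]
    themselves, and the zero functional because it gives a zero row. *)
Lemma row_functional (R : numDomainType) (n m : nat)
    (K : 'M[bool]_(n, m)) f g i :
  row_frame R K f g -> reduced_rows K -> reduced_rows K^T -> 3 < m ->
  (forall x, f x != i) ->
  exists2 v, v \in proper_functionals &
    forall j, (K i j)%:R%R = dot v (pattern K f j).
Proof.
move=> rf [Kneq0 Kdist] Kr m4 fi; have [span _] := rf; have [w wE] := span i.
have [|v vF vE] := small_functional (w := w).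
  apply: leq_ltn_trans m4 (count_patterns rf Kr _ _).
    by rewrite /is01 /dot /= !mulr0 !addr0 eqxx.
  by move=> j; rewrite /is01 -wE; case: (K i j); rewrite eqxx ?orbT.
have KvE j : (K i j)%:R%R = dot v (pattern K f j).
  by apply/eqP; rewrite -(eqr_int R) -vE -wE rmorph_nat.
exists v => //; move: vF; rewrite mem_cat => /orP[vC|//]; exfalso.
have [j Kij] := Kneq0 i.
have row_f x : (forall j, (K i j)%:R = (K (f x) j)%:R :> int)%R -> False.
  move=> rowE; case/eqP: (fi x); apply: Kdist => j'.
  exact: (natr_bool_inj (R := int)).
move: vC; rewrite !inE => /or4P[]/eqP v_eq.
- by have := KvE j; rewrite v_eq Kij /dot /= !mul0r.
- apply: (row_f i0) => j'; rewrite KvE v_eq /dot /=; ring.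
- apply: (row_f i1) => j'; rewrite KvE v_eq /dot /=; ring.
- apply: (row_f i2) => j'; rewrite KvE v_eq /dot /=; ring.
Qed.

Definition extra_rows (n : nat) (f : 'I_3 -> 'I_n) : {set 'I_n} :=
  ~: [set f x | x in 'I_3].

Lemma extra_rowsP (n : nat) (f : 'I_3 -> 'I_n) i :
  reflect (forall x, f x != i) (i \in extra_rows f).
Proof.
rewrite inE; apply: (iffP idP) => [iNf x|fi].
  by apply: contra iNf => /eqP<-; apply: imset_f.
by apply/imsetP => -[x _ ix]; have := fi x; rewrite ix eqxx.
Qed.

Lemma card_extra_rows (n : nat) (f : 'I_3 -> 'I_n) : n - 3 <= #|extra_rows f|.
Proof.
rewrite cardsCs setCK card_ord leq_sub2l //.
by rewrite -[leqRHS]card_ord leq_imset_card.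
Qed.

(** Two rows outside [f] have different proper functionals, which are
    simultaneously 0-1 valued at no more than five points, the origin
    included. *)
Lemma reduced_small (R : numDomainType) (n m : nat) (K : 'M[bool]_(n, m)) f g :
  row_frame R K f g -> reduced_rows K -> reduced_rows K^T ->
  (n <= 4) || (m <= 4).
Proof.
move=> rf Kr Kc; rewrite leqNgt -implybE; apply/implyP => n5.
rewrite leqNgt; apply/negP => m5.
have /card_gt1P[i [i' [/extra_rowsP fi /extra_rowsP fi' ii']]] :
    1 < #|extra_rows f|.
  by apply: leq_trans (card_extra_rows f); lia.
have m4 : 3 < m by lia.
have [v vP vE] := row_functional rf Kr Kc m4 fi.
have [v' v'P v'E] := row_functional rf Kr Kc m4 fi'.
have vv' : v != v'.
  apply: contraNN ii' => /eqP vv'; apply/eqP; case: Kr => _; apply=> j.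
  by apply: (natr_bool_inj (R := int)); rewrite vE v'E vv'.
have /allP/(_ v vP)/allP/(_ v' v'P)/implyP/(_ vv') :=
  proper_functionals_disagree.
rewrite leqNgt => /negP[]; apply: leq_ltn_trans m5 _.
apply: (count_patterns rf Kc) => [|j].
  by rewrite /is01 /dot /= !mulr0 !addr0 eqxx.
rewrite -vE -v'E /is01; by case: (K i j); case: (K i' j).
Qed.

(** * Isolation sets of size 3 *)

Lemma has_isolated3P (n m : nat) (K : 'M[bool]_(n, m)) (g : 'I_3 -> 'I_m)
    (rs : seq 'I_n) :
  has_isolated3 [seq pattern K^T g i | i <- rs] ->
  exists f : 'I_3 -> 'I_n, isolated K f g.
Proof.
case/hasP => _ /mapP[a _ ->] /hasP[_ /mapP[b _ ->] /hasP[_ /mapP[c _ ->]]].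
rewrite /isolated3 /= !mxE => iso.
exists (fun x => nth a [:: a; b; c] x); split.
  by apply: ord3P => /=; case/and5P: iso => // _ _ ? _ /andP[].
case/and5P: iso => _ _ _ ab /andP[ac bc].
by apply: ord3P; apply: ord3P => //= _; rewrite // andbC.
Qed.

Lemma extra_row_isolated (R : numDomainType) (n m : nat)
    (K : 'M[bool]_(n, m)) f g :
  frame R K f g -> reduced_rows K -> 3 < n ->
  exists f' g' : 'I_3 -> _, isolated K f' g'.
Proof.
move=> [rf cf] Kr n4.
have /card_gt0P[i /extra_rowsP fi] : 0 < #|extra_rows f|.
  by apply: leq_trans (card_extra_rows f); lia.
have Kr' : reduced_rows K^T^T by rewrite trmxK.
have iP : pattern K^T g i \notin
    [:: (false, false, false); pattern K^T g (f i0); pattern K^T g (f i1);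
        pattern K^T g (f i2)].
  by rewrite !inE (negbTE (pattern_neq0 i cf Kr'))
    !(inj_eq (pattern_inj cf Kr')) ![i == _]eq_sym !(negbTE (fi _)).
have /allP/(_ _ (mem_cube _))/allP/(_ _ (mem_cube _))/allP/(_ _ (mem_cube _))
  /implyP/(_ (frame_independent rf))/allP/(_ _ (mem_cube _))/implyP/(_ iP)
  := independent_extra_isolated.
case/(@has_isolated3P _ _ K g [:: f i0; f i1; f i2; i]) => f' iso.
by exists f', g.
Qed.

Lemma bit_pattern (n m : nat) (K : 'M[bool]_(n, m)) (g : 'I_3 -> 'I_m) i y :
  bit (pattern K^T g i) y = K i (g y).
Proof. by elim/ord3P: y; rewrite /bit /= mxE. Qed.

Lemma mxsub_inj_rows (n m p q : nat) (K : 'M[bool]_(n, m))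
    (C : 'M[bool]_(p, q)) f g :
  distinct_rows C -> C = mxsub f g K -> injective f.
Proof. by move=> Cdist CK x y fxy; apply: Cdist => z; rewrite CK !mxE fxy. Qed.

Lemma mxsub_inj_cols (n m p q : nat) (K : 'M[bool]_(n, m))
    (C : 'M[bool]_(p, q)) f g :
  distinct_rows C^T -> C = mxsub f g K -> injective g.
Proof.
move=> Cdist CK; apply: (mxsub_inj_rows (K := K^T) Cdist).
by rewrite CK trmx_mxsub.
Qed.

Lemma A7_distinct_rows : distinct_rows A7.
Proof.
move=> x y rowE; move: (rowE i0) (rowE i1) (rowE i2); rewrite !mxE.
by elim/ord3P: x {rowE}; elim/ord3P: y.
Qed.

Lemma A7_distinct_cols : distinct_rows A7^T.
Proof.
move=> x y colE; move: (colE i0) (colE i1) (colE i2); rewrite !mxE.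
by elim/ord3P: x {colE}; elim/ord3P: y.
Qed.

Lemma has_A7P (n m : nat) (K : 'M[bool]_(n, m)) (g : 'I_3 -> 'I_m)
    (rs : seq 'I_n) :
  has_A7 [seq pattern K^T g i | i <- rs] ->
  exists (f : 'I_3 -> 'I_n) (g' : 'I_3 -> 'I_m), A7 = mxsub f g' K.
Proof.
case/hasP => _ /mapP[a _ ->] /hasP[_ /mapP[b _ ->] /hasP[_ /mapP[c _ ->]]].
case/hasP => s _ /hasP[t _ /hasP[u _]]; rewrite /is_A7 !bit_pattern.
case/and5P=> as_ at_ /negbTE au /negbTE bs /and5P[bt bu cs ct cu].
exists (fun x => nth a [:: a; b; c] x), (fun y => g (nth s [:: s; t; u] y)).
apply/matrixP; apply: ord3P; apply: ord3P; rewrite !mxE /=;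
  by rewrite ?as_ ?at_ ?au ?bs ?bt ?bu ?cs ?ct ?cu.
Qed.

Lemma isolated_or_A7 (R : numDomainType) (n m : nat)
    (K : 'M[bool]_(n, m)) f g :
  frame R K f g -> reduced_rows K -> reduced_rows K^T ->
  (exists f' g' : 'I_3 -> _, isolated K f' g') \/ equal_upto_perm K A7.
Proof.
move=> fr Kr Kc.
case: (ltnP 3 n) => [n4|n3]; first by left; apply: extra_row_isolated fr Kr n4.
case: (ltnP 3 m) => [m4|m3].
  have [g' [f' iso]] := extra_row_isolated (frame_tr fr) Kc m4.
  by left; exists f', g'; apply: isolated_tr.
have /allP/(_ _ (mem_cube _))/allP/(_ _ (mem_cube _))/allP/(_ _ (mem_cube _))
  /implyP/(_ (frame_independent fr.1))/andP[_]
  := independent_isolated_or_A7.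
case/orP=> [/(@has_isolated3P _ _ K g [:: f i0; f i1; f i2])[f' iso]|].
  by left; exists f', g.
case/(@has_A7P _ _ K g [:: f i0; f i1; f i2]) => f' [g' A7K].
right; exists f', g'; split=> //.
  apply: inj_card_bij; last by rewrite !card_ord.
  exact: mxsub_inj_rows A7_distinct_rows A7K.
apply: inj_card_bij; last by rewrite !card_ord.
exact: mxsub_inj_cols A7_distinct_cols A7K.
Qed.

(** * Binary factorizations of size 3 *)

(** The rows other than [a] generate all rows without overlap. *)
Lemma rank_bin_sum_row (n m : nat) (K : 'M[bool]_(n.+1, m)) (a b c : 'I_n.+1) :
  b != a -> c != a -> b != c ->
  (forall j, K a j = K b j + K c j :> nat) -> rank_bin K <= n.
Proof.
move=> ba ca bc sumE; apply/rank_bin_min/bin_factorP.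
pose C i k := if i == a then (k == b) || (k == c) else k == i.
exists (\matrix_(i, k) C i (lift a k))%R, (rowsub (lift a) K) => i j.
have -> : \sum_k (\matrix_(i, k) C i (lift a k))%R i k * rowsub (lift a) K k j
    = \sum_k C i k * K k j.
  have Ca : C i a = false.
    rewrite /C [a == i]eq_sym; case: (i == a); last by [].
    by rewrite ![a == _]eq_sym (negbTE ba) (negbTE ca).
  rewrite [RHS](bigD1_ord a) //= Ca add0n.
  by apply: eq_bigr => k _; rewrite !mxE.
rewrite /C; case: (eqVneq i a) => [->|ia].
  rewrite (bigD1 b) //= (bigD1 c) 1?eq_sym //= !eqxx /= ?orbT big1.
    by rewrite sumE addn0 !mul1n.
  by move=> k /andP[/negbTE-> /negbTE->].
rewrite (bigD1 i) //= eqxx mul1n big1 ?addn0 //.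
by move=> k /negbTE->.
Qed.

(** As row [d] is contained in row [a], the difference a - d is again a 0-1
    row; with [b] and [d] it generates [a] = d + (a - d) and
    [c] = b + (a - d). *)
Lemma rank_bin_balanced (n m : nat) (K : 'M[bool]_(n, m)) (a b c d : 'I_n) :
  (forall i, i \in [:: a; b; c; d]) ->
  (forall j, K a j + K b j = K c j + K d j :> nat) ->
  (forall j, K d j -> K a j) -> rank_bin K <= 3.
Proof.
move=> abcd bal da; apply/rank_bin_min/bin_factorP.
pose A (i : 'I_n) : seq bool :=
  if i == a then [:: true; false; true]
  else if i == b then [:: false; true; false]
  else if i == d then [:: true; false; false] else [:: false; true; true].
exists (\matrix_(i, k) nth false (A i) k)%R.
exists (\matrix_(k, j) nth false [:: K d j; K b j; K a j && ~~ K d j] k)%R.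
move=> i j; rewrite !big_ord_recl big_ord0 !mxE /= addn0.
have := bal j; have := da j; rewrite /A.
have := abcd i; rewrite !inE.
case: eqVneq => [->|_] /=.
  by move=> _; case: (K d j) (K a j) => [] [] // /(_ isT).
case: eqVneq => [->|_] /=; first by case: (K b j).
rewrite orbC; case: eqVneq => [->|_] /=; first by case: (K d j).
move=> /eqP-> /implyP.
by case: (K d j) (K a j) (K b j) (K c j) => [] [] [] [].
Qed.

Lemma frame_inj (R : numDomainType) (n m : nat) (K : 'M[bool]_(n, m)) f g :
  row_frame R K f g -> injective f.
Proof.
move=> rf.
have /allP/(_ _ (mem_cube _))/allP/(_ _ (mem_cube _))/allP/(_ _ (mem_cube _))
  /implyP/(_ (frame_independent rf))/andP[+ _]
  := independent_isolated_or_A7.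
move/(@map_uniq _ _ (pattern K^T g) [:: f i0; f i1; f i2]) => /=.
rewrite !inE negb_or => /and3P[/andP[/eqP n01 /eqP n02] /eqP n12 _].
by apply: ord3P; apply: ord3P => // /esym.
Qed.

(** A functional x + y or x - y makes one of three rows the sum of the other
    two; a functional x + y - z puts row [i] in a relation of the form
    a + b = c + d with the three rows [f]. *)
Lemma proper_relation (n m : nat) (K : 'M[bool]_(n, m)) (f : 'I_3 -> 'I_n) i v :
  v \in proper_functionals ->
  (forall j, (K i j)%:R%R = dot v (pattern K f j)) ->
  (exists a b c, forall j, K a j = K b j + K c j :> nat) \/
  (exists x y z, uniq [:: x; y; z] /\
     forall j, K i j + K (f x) j = K (f y) j + K (f z) j :> nat).
Proof.
move=> vP KvE.
have is_sum (a b c : 'I_n) :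
    (forall j, (K a j)%:R = (K b j)%:R + (K c j)%:R :> int)%R ->
    (exists a b c, forall j, K a j = K b j + K c j :> nat) \/
    (exists x y z, uniq [:: x; y; z] /\
       forall j, K i j + K (f x) j = K (f y) j + K (f z) j :> nat).
  move=> abc; left; exists a, b, c => j.
  by apply/eqP; rewrite -(eqr_nat int) natrD abc.
have is_balanced (x y z : 'I_3) : uniq [:: x; y; z] ->
    (forall j, (K i j)%:R + (K (f x) j)%:R =
               (K (f y) j)%:R + (K (f z) j)%:R :> int)%R ->
    (exists a b c, forall j, K a j = K b j + K c j :> nat) \/
    (exists x y z, uniq [:: x; y; z] /\
       forall j, K i j + K (f x) j = K (f y) j + K (f z) j :> nat).
  move=> xyz bal; right; exists x, y, z; split=> // j.
  by apply/eqP; rewrite -(eqr_nat int) !natrD bal.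
move: vP; rewrite !inE; do ![case/orP]; move=> /eqP v_eq.
- by apply: (is_sum i (f i0) (f i1)) => j; rewrite KvE v_eq /dot /=; ring.
- by apply: (is_sum i (f i0) (f i2)) => j; rewrite KvE v_eq /dot /=; ring.
- by apply: (is_sum i (f i1) (f i2)) => j; rewrite KvE v_eq /dot /=; ring.
- by apply: (is_sum (f i0) i (f i1)) => j; rewrite KvE v_eq /dot /=; ring.
- by apply: (is_sum (f i1) i (f i0)) => j; rewrite KvE v_eq /dot /=; ring.
- by apply: (is_sum (f i0) i (f i2)) => j; rewrite KvE v_eq /dot /=; ring.
- by apply: (is_sum (f i2) i (f i0)) => j; rewrite KvE v_eq /dot /=; ring.
- by apply: (is_sum (f i1) i (f i2)) => j; rewrite KvE v_eq /dot /=; ring.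
- by apply: (is_sum (f i2) i (f i1)) => j; rewrite KvE v_eq /dot /=; ring.
- by apply: (is_balanced i2 i0 i1) => // j; rewrite KvE v_eq /dot /=; ring.
- by apply: (is_balanced i1 i0 i2) => // j; rewrite KvE v_eq /dot /=; ring.
- by apply: (is_balanced i0 i1 i2) => // j; rewrite KvE v_eq /dot /=; ring.
Qed.

(** * The matrix C4 and matrices with four rows *)

Definition o4 k (lt : k < 4) : 'I_4 := Ordinal lt.

Lemma C4_distinct_rows : distinct_rows C4.
Proof.
move=> x y rowE; apply: val_inj.
move: (rowE (@o4 0 isT)) (rowE (@o4 1 isT)).
move: (rowE (@o4 2 isT)) (rowE (@o4 3 isT)).
rewrite !mxE.
by case: x {rowE} => [[|[|[|[]]]] //= ?]; case: y => [[|[|[|[]]]] //= ?].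
Qed.

Lemma C4_distinct_cols : distinct_rows C4^T.
Proof.
move=> x y rowE; apply: val_inj.
move: (rowE (@o4 0 isT)) (rowE (@o4 1 isT)).
move: (rowE (@o4 2 isT)) (rowE (@o4 3 isT)).
rewrite !mxE.
by case: x {rowE} => [[|[|[|[]]]] //= ?]; case: y => [[|[|[|[]]]] //= ?].
Qed.

Lemma contains_C4 (n m : nat) (K : 'M[bool]_(n, m)) f g :
  C4 = mxsub f g K -> contains_upto_perm K C4.
Proof.
move=> CK; exists f, g; split=> //.
  exact: mxsub_inj_rows C4_distinct_rows CK.
exact: mxsub_inj_cols C4_distinct_cols CK.
Qed.

(** The transpose of [C4] is [C4] with its rows rotated. *)
Lemma contains_C4_tr (n m : nat) (K : 'M[bool]_(n, m)) :
  contains_upto_perm K^T C4 -> contains_upto_perm K C4.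
Proof.
case=> f [g [_ _ CK]].
apply: (@contains_C4 _ _ K (fun x => g (ordS x)) f).
have C4tr x y : K (g x) (f y) = C4 y x by rewrite CK !mxE.
apply/matrixP => x y; rewrite [RHS]mxE C4tr !mxE.
by case: x => [[|[|[|[]]]] //= ?]; case: y => [[|[|[|[]]]] //= ?].
Qed.

Lemma C4_isolated (n m : nat) (K : 'M[bool]_(n, m)) :
  contains_upto_perm K C4 -> exists f g : 'I_4 -> _, isolated K f g.
Proof.
case=> f [g [_ _ CK]]; exists f, g.
have KE x y : K (f x) (g y) = C4 x y by rewrite CK mxE.
split=> [x|x y]; rewrite !KE !mxE.
  by case: x => [[|[|[|[]]]] //= ?].
by case: x => [[|[|[|[]]]] //= ?]; case: y => [[|[|[|[]]]] //= ?].
Qed.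

(** A nonzero column, as the set of rows that it meets, is one of {a,b,c,d},
    {a,c}, {a,d}, {b,c}, {b,d}. In the cyclic order a, c, b, d of the rows the
    four pairs are the columns of [C4]; a missing pair is a containment between
    two rows, and [rank_bin_balanced] applies after renaming. *)
Lemma balanced_C4 (n m : nat) (K : 'M[bool]_(n, m)) (a b c d : 'I_n) :
  (forall i, i \in [:: a; b; c; d]) ->
  (forall j, K a j + K b j = K c j + K d j :> nat) ->
  contains_upto_perm K C4 \/ rank_bin K <= 3.
Proof.
move=> abcd bal.
case: (boolP [forall j, K d j ==> K a j]) => [/forallP sub|].
  by right; apply: (rank_bin_balanced abcd bal) => j; apply/implyP.
rewrite negb_forall => /existsP[jbd]; rewrite negb_imply => /andP[dbd abd].
case: (boolP [forall j, K d j ==> K b j]) => [/forallP sub|].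
  right; apply: (@rank_bin_balanced _ _ K b a c d) => j; last exact/implyP.
    by have := abcd j; rewrite !inE orbCA.
  by rewrite addnC.
rewrite negb_forall => /existsP[jad]; rewrite negb_imply => /andP[dad bad].
case: (boolP [forall j, K c j ==> K a j]) => [/forallP sub|].
  right; apply: (@rank_bin_balanced _ _ K a b d c) => j; last exact/implyP.
    by have := abcd j; rewrite !inE [X in _ || (_ || X)]orbC.
  by rewrite bal addnC.
rewrite negb_forall => /existsP[jbc]; rewrite negb_imply => /andP[cbc abc].
case: (boolP [forall j, K c j ==> K b j]) => [/forallP sub|].
  right; apply: (@rank_bin_balanced _ _ K b a d c) => j; last exact/implyP.
    by have := abcd j; rewrite !inE orbCA [X in _ || (_ || X)]orbC.
  by rewrite addnC bal addnC.
rewrite negb_forall => /existsP[jac]; rewrite negb_imply => /andP[cac bac].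
left; apply: (@contains_C4 _ _ K (fun x => nth a [:: a; c; b; d] x)
  (fun y => nth jad [:: jad; jac; jbc; jbd] y)).
move: (bal jbd) (bal jad) (bal jbc) (bal jac).
move: abd bad abc bac; rewrite dbd dad cbc cac => /negbTE abd /negbTE bad.
move=> /negbTE abc /negbTE bac; rewrite abd bad abc bac.
move=> e1 e2 e3 e4; apply/matrixP => x y; rewrite !mxE.
case: x => [[|[|[|[]]]] //= ?]; case: y => [[|[|[|[]]]] //= ?].
all: rewrite ?dbd ?dad ?cbc ?cac ?abd ?bad ?abc ?bac //.
all: move: e1 e2 e3 e4.
all: do ![case: (K _ _) => //].
Qed.

Lemma uniq4_cover (s : seq 'I_4) : uniq s -> size s = 4 -> forall i, i \in s.
Proof.
move=> s_uniq s4 i; apply: contraT => iNs.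
have /card_uniqP sE : uniq (i :: s) by rewrite /= iNs.
by have := max_card [in i :: s]; rewrite sE card_ord /= s4.
Qed.

Lemma rank_bin_4rows (R : numDomainType) (n m : nat) (K : 'M[bool]_(n, m)) f g :
  row_frame R K f g -> reduced_rows K -> reduced_rows K^T -> n = 4 ->
  contains_upto_perm K C4 \/ rank_bin K <= 3.
Proof.
move=> rf Kr Kc n4; case: (leqP m 3) => [m3|m4].
  by right; rewrite -rank_bin_tr (leq_trans (rank_bin_le_rows _)).
subst n.
have /card_gt0P[i /extra_rowsP fi] : 0 < #|extra_rows f|.
  exact: leq_trans (card_extra_rows f).
have [v vP KvE] := row_functional rf Kr Kc m4 fi.
have [[a [b [c sumE]]]|[x [y [z [xyz bal]]]]] := proper_relation vP KvE.
  have [Kneq0 _] := Kr.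
  right; apply: (rank_bin_sum_row (a := a) (b := b) (c := c) _ _ _ sumE);
    apply/eqP => E.
  - have [j Kcj] := Kneq0 c; have := sumE j; by rewrite E Kcj; lia.
  - have [j Kbj] := Kneq0 b; have := sumE j; by rewrite E Kbj; lia.
  - have [j Kbj] := Kneq0 b; have := sumE j; rewrite -E Kbj.
    by case: (K a j).
apply: balanced_C4 bal; apply: uniq4_cover => //.
rewrite -/(map f [:: x; y; z]) cons_uniq.
rewrite (map_inj_uniq (frame_inj rf)) xyz andbT.
by apply/mapP => -[u _ ifu]; have := fi u; rewrite -ifu eqxx.
Qed.

Lemma rank_bin_le3_or_C4 (R : numDomainType) (n m : nat)
    (K : 'M[bool]_(n, m)) f g :
  frame R K f g -> reduced_rows K -> reduced_rows K^T ->
  contains_upto_perm K C4 \/ rank_bin K <= 3.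
Proof.
move=> [rf cf] Kr Kc.
case: (leqP n 3) => [n3|n4].
  by right; apply: leq_trans (rank_bin_le_rows _) n3.
case: (leqP m 3) => [m3|m4].
  by right; rewrite -rank_bin_tr (leq_trans (rank_bin_le_rows _)).
case/orP: (reduced_small rf Kr Kc) => [n4'|m4'].
  by apply: rank_bin_4rows rf Kr Kc _; apply/eqP; rewrite eqn_leq n4'.
have Kr' : reduced_rows K^T^T by rewrite trmxK.
have [|C4K|] := rank_bin_4rows cf Kc Kr'.
- by apply/eqP; rewrite eqn_leq m4'.
- by left; apply: contains_C4_tr.
- by rewrite rank_bin_tr; right.
Qed.

(** * The matrix A7 and the main theorem *)

(** The last row of [A7] is the union of the other two. *)
Lemma A7_rank_bool (n m : nat) (K : 'M[bool]_(n, m)) :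
  equal_upto_perm K A7 -> rank_bool K <= 2.
Proof.
move=> [f [g [[f' _ fK] [g' _ gK] KA7]]]; apply/rank_bool_min/bool_factorP.
have KE x y : K (f x) (g y) = A7 x y by rewrite KA7 mxE.
exists (\matrix_(i < n, k < 2) K i (g (nth i0 [:: i0; i2] k)))%R.
exists (\matrix_(k < 2, j < m) K (f (nth i0 [:: i0; i1] k)) j)%R => i j.
have ex2 (p : pred 'I_2) : [exists k, p k] = p ord0 || p (lift ord0 ord0).
  by have := big_orE xpredT p; rewrite !big_ord_recl big_ord0 orbF => ->.
rewrite ex2 -[i]fK -[j]gK !mxE /= !KE !mxE.
by elim/ord3P: (f' i); elim/ord3P: (g' j).
Qed.

Lemma A7_isolated (n m : nat) (K : 'M[bool]_(n, m)) :
  equal_upto_perm K A7 -> exists f g : 'I_2 -> _, isolated K f g.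
Proof.
move=> [f [g [_ _ KA7]]].
have KE x y : K (f x) (g y) = A7 x y by rewrite KA7 mxE.
exists (fun x => f (nth i0 [:: i0; i1] x)), (fun x => g (nth i0 [:: i0; i2] x)).
split=> [x|x y]; rewrite !KE !mxE.
  by case: x => [[|[|[]]] //= ?].
by case: x => [[|[|[]]] //= ?]; case: y => [[|[|[]]] //= ?].
Qed.

Lemma kernel_isolated (k n m : nat) (M : 'M[bool]_(n, m)) :
  (exists f g : 'I_k -> _, isolated (kernel M) f g) ->
  k <= isolation_number M.
Proof.
move=> [f [g [ones iso]]].
apply: (@isolated_le _ _ _ _
  (fun x => enum_val (f x)) (fun x => enum_val (g x))).
split=> [x|x y xy]; first by have := ones x; rewrite kernelE.
by have := iso x y xy; rewrite !kernelE.
Qed.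

Theorem theorem3 (R : realType) (n m : nat) (M : 'M[bool]_(n, m))
  (rankM : \rank (mx01 R M) = 3) :
  [/\ (#|kernel_rows M| <= 4) || (#|kernel_cols M| <= 4),
      (rank_bin M = 4 /\ rank_bool M = 4) <->
        contains_upto_perm (kernel M) C4
    & (~ equal_upto_perm (kernel M) A7 ->
         isolation_number M = rank_bin M /\ rank_bin M = rank_bool M) /\
      (equal_upto_perm (kernel M) A7 ->
         [/\ rank_bin M = 3, rank_bool M = 2 & isolation_number M = 2])].
Proof.
have Kr := kernel_reduced_rows M; have Kc := kernel_reduced_cols M.
have [f [g fr]] : exists f g, frame R (kernel M) f g.
  by apply: frame_exists; rewrite rank_kernel.
have small := reduced_small fr.1 Kr Kc.
have [phi [psi MK]] := kernel_blowup M.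
have bin_ge3 : 3 <= rank_bin M by rewrite -rankM rank_le_bin.
have binK := rank_bin_blowup MK; have boolK := rank_bool_blowup MK.
have iso_bool := isolation_le_bool M; have bool_bin := rank_bool_le_bin M.
have bin_le4 : rank_bin M <= 4.
  apply: leq_trans binK _; case/orP: small => [n4|m4].
    exact: leq_trans (rank_bin_le_rows _) n4.
  by rewrite -rank_bin_tr (leq_trans (rank_bin_le_rows _)).
have C4_case : 4 <= isolation_number M /\ contains_upto_perm (kernel M) C4 \/
    rank_bin M <= 3.
  have [C4K|bin3] := rank_bin_le3_or_C4 fr Kr Kc; last by right; lia.
  by left; split=> //; apply/kernel_isolated/C4_isolated.
split=> //.
- split=> [[bin4 bool4]|C4K]; first by case: C4_case => [[]//|]; lia.
  have := kernel_isolated (C4_isolated C4K); lia.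
- split=> [notA7|A7K].
    have [/kernel_isolated iso3|//] := isolated_or_A7 fr Kr Kc.
    by case: C4_case => [[iso4 _]|bin3]; lia.
  have iso2 := kernel_isolated (A7_isolated A7K).
  have bool2 := A7_rank_bool A7K.
  have bin3 : rank_bin (kernel M) <= 3.
    have [f' [_ [f'_bij _ _]]] := A7K.
    apply: leq_trans (rank_bin_le_rows _) _.
    by have := bij_eq_card f'_bij; rewrite !card_ord => <-.
  by split; lia.
Qed.
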